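(* For $n = 2^{\widehat{n}}-1 +\theta$, where $(\theta,\xi) =\Theta(2^{\widehat{n}})$, $m \geq 0$, and any $m$-decomposition $S$ of $2^{\widehat{n}}-1$ (with $m<\theta-|S|$), \[ \chi_{n+m} \geq 2^{m - 2^{\widehat{n}}} \prod\limits_{ s \in S} \lambda(s). \]
   Context: $\mathcal{Q}_n$ is the $n$-dimensional hypercube (binary words of length $n$ with Hamming distance); $\gamma_n$ is the minimum size of a set $\Delta\subseteq\mathcal{Q}_n$ such that every vertex is within distance $1$ of some element of $\Delta$. For a positive integer $n$ write $n = 2^{\widehat{n}}-1+\check{n}$ with $0\le \check{n}<2^{\widehat{n}}$, and define $\chi_n := 1-\gamma_n\cdot 2^{\widehat{n}-n}$. For a positive integer $q$, $\Theta(q)$ is the unique pair $(\theta,\xi)$ of non-negative integers with $\binom{\theta+1}{2}=q+\xi$ and $0\le\xi<\theta+1$. With $l=2^{\widehat{n}}-1$, $(\theta,\xi)=\Theta(l+1)$ and $m\ge0$, an $m$-decomposition of $l$ is a set $S=\{s_1<\dots<s_q\}$ with $1\le s_1$, $s_q<\theta$ and $\theta+m+\sum_{s\in S}s=l+1$. $\lambda(s)$ denotes the maximal size of a subset of $\mathcal{Q}_s$ whose distinct elements are pairwise at distance at least $3$. In the claim, $\widehat{n}$ is the exponent used to define $l=2^{\widehat{n}}-1$ (the paper applies this for $\widehat{n}>2$). *)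

(* Defs.v *)
From mathcomp Require Import all_boot all_order all_algebra.
Set Implicit Arguments.
Unset Strict Implicit.
Unset Printing Implicit Defensive.
Import Order.TTheory GRing.Theory Num.Theory.

Definition cube (n : nat) := {ffun 'I_n -> bool}.

Definition hamming (n : nat) (x y : cube n) : nat := #|[set i | x i != y i]|.

Definition covering (n : nat) (D : {set cube n}) : bool :=
  [forall x, exists y in D, hamming x y <= 1].

Lemma covering_setT (n : nat) : covering [set: cube n].
Proof.
apply/forallP => x; apply/existsP; exists x; rewrite in_setT /=.
rewrite /hamming (_ : [set i | _] = set0) ?cards0 //.
by apply/setP => i; rewrite !inE eqxx.
Qed.

(* The default [set: cube n] of the arg min is covering (covering_setT), so
   this is a genuine minimum. *)
Definition gamma (n : nat) : nat :=
  #|[arg min_(D < [set: cube n] | covering D) #|D|]|.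

Definition distance3_code (n : nat) (C : {set cube n}) : bool :=
  [forall x in C, forall y in C, (x != y) ==> (3 <= hamming x y)].

Definition lambda (s : nat) : nat :=
  \max_(C : {set cube s} | distance3_code C) #|C|.

(* The exponent and the remainder in n = 2 ^ hat n - 1 + check n with
   0 <= check n < 2 ^ hat n; see hat_checkP and hat_check_uniq. *)
Definition hat (n : nat) : nat := trunc_log 2 n.+1.
Definition check (n : nat) : nat := n - (2 ^ hat n - 1).

Lemma hat_checkP (n : nat) :
  n = 2 ^ hat n - 1 + check n /\ check n < 2 ^ hat n.
Proof.
rewrite /check /hat; have /andP[] := @trunc_log_bounds 2 n.+1 isT isT.
set k := trunc_log _ _; rewrite expnS mul2n -addnn => le_kn lt_nk.
have k_gt0 : 0 < 2 ^ k by rewrite expn_gt0.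
have le_k1 : 2 ^ k - 1 <= n by rewrite leq_subLR add1n.
split; first by rewrite subnKC.
by rewrite ltn_subLR // addBnAC // ltn_subRL add1n.
Qed.

Lemma hat_check_uniq (n h c : nat) :
  n = 2 ^ h - 1 + c -> c < 2 ^ h -> hat n = h /\ check n = c.
Proof.
move=> -> lt_ch; have h_gt0 : 0 < 2 ^ h by rewrite expn_gt0.
have hatE : hat (2 ^ h - 1 + c) = h.
  apply: trunc_log_eq => //.
  by rewrite -addSn subn1 prednK // leq_addr expnS mul2n -addnn ltn_add2l.
by rewrite /check hatE addKn.
Qed.

Definition chi (n : nat) : rat :=
  (1 - (gamma n)%:R * 2%:R ^ ((hat n)%:Z - n%:Z))%R.

(* Theta q (theta, xi) reads "(theta, xi) = Theta(q)".  The pair is unique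
   unless q is a triangular number (see Theta_uniq), hence for q = 2 ^ h with
   h > 0 (see Theta_expn2_uniq). *)
Definition Theta (q : nat) (p : nat * nat) : Prop :=
  let: (theta, xi) := p in 'C(theta.+1, 2) = q + xi /\ xi < theta.+1.

(* theta is meant to be the first component of Theta(l + 1); the set S is
   encoded as its strictly increasing enumeration. *)
Definition decomposition (l theta m : nat) (S : seq nat) : Prop :=
  [/\ sorted ltn S,
      forall s, s \in S -> 1 <= s < theta
    & theta + m + \sum_(s <- S) s = l + 1].

Lemma Theta_uniq (q : nat) (p1 p2 : nat * nat) :
  (forall k, q != 'C(k.+1, 2)) -> Theta q p1 -> Theta q p2 -> p1 = p2.
Proof.
wlog le12 : p1 p2 / p1.1 <= p2.1 => [WH ntri T1 T2|].
  by have [|/ltnW] := leqP p1.1 p2.1 => le; [|symmetry]; apply: WH.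
case: p1 p2 le12 => [t1 x1] [t2 x2] /= le12 ntri [E1 _] [E2 lt2].
have [lt12|ge12] := ltnP t1 t2; last first.
  have E : t1 = t2 by apply/eqP; rewrite eqn_leq le12.
  by subst t2; move: E2; rewrite E1 => /addnI ->.
case: t2 => [|k] in le12 lt12 E2 lt2 *; first by [].
have := @leq_bin2l t1.+1 k.+1 2 lt12; rewrite E1.
move: E2; rewrite binS bin1 => E2 le_q.
have := ntri k; case/eqP; apply/eqP; rewrite eqn_leq.
rewrite (leq_trans (leq_addr x1 q) le_q) /=.
by rewrite -(leq_add2r k.+1) E2 leq_add2l.
Qed.

Lemma Theta_expn2_uniq (h : nat) (p1 p2 : nat * nat) :
  0 < h -> Theta (2 ^ h) p1 -> Theta (2 ^ h) p2 -> p1 = p2.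
Proof.
move=> h_gt0; apply: Theta_uniq => k; apply/eqP => E.
have {}E : 2 ^ h.+1 = k.+1 * k.
  by rewrite expnSr E (bin_ffact k.+1 2) ffactSS ffactn1.
have odd1 a : odd a -> a %| 2 ^ h.+1 -> a = 1.
  move=> odd_a dv; apply/eqP; rewrite -dvdn1 -(@Gauss_dvdr a (2 ^ h.+1)) ?muln1 //.
  by rewrite coprimeXr // coprimen2.
have [odd_k|even_k] := boolP (odd k).
  have k1 : k = 1 by apply: odd1 => //; rewrite E dvdn_mull.
  by move: E; rewrite k1 -[RHS]expn1 => /eqP; rewrite eqn_exp2l // eqSS gtn_eqF.
have k0 : k.+1 = 1 by apply: odd1 => //; rewrite E dvdn_mulr.
by case: k0 E => -> /eqP; rewrite expn_eq0.
Qed.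

(* Main.v *)
Require Import Defs.
From mathcomp Require Import all_boot all_order all_algebra.
From mathcomp Require Import zify ring.
Import Order.TTheory GRing.Theory Num.Theory.

(** Split a word of [Q_(n+m)] into [x] of length [2^h - 1] and [y] of length
    [theta + m], write [d = theta - 1], and let [H x] be the Hamming syndrome
    of [x].  For any map [f], the code [H x = f y] covers each layer [y] by
    itself.  Label the syndromes (one per coordinate of [x], plus [0]) by
    [theta + m] directions [a_p] of [y] (with [a_d = 0] for the last head
    direction) and, for every [i < |S|], by a block of size [t_i], where
    [t_0 > t_1 > ...] enumerates [S]; since [t_i <= d - i], the coordinates of
    block [i] can be paired with directions [k] such that [i < k <= d].

    Above a hole, i.e. a layer [y0] whose head is zero, all the codewords whose
    blocks lie in the distance-3 codes [C_i] are deleted.  The layer [y0 + e_i]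
    takes over the words at distance at most 1 from them with syndrome [a_i] or
    in block [i]: there the code is [H x = lead_i (block i of x)] up to a
    translation, where [lead_i] is [j] on words at distance 1 from [C_i] in
    direction [j] (well defined by distance 3) and [a_i] elsewhere.  The layers
    whose first nonzero head coordinate is [i] still cover themselves whatever
    [lead_i] is: an error in a coordinate of block [i] is corrected by flipping
    the direction of [y] paired with it, any other one by flipping [x].  The
    [2^m] hole layers are pairwise non-adjacent because the last head
    coordinate is twisted by the parity of the tail.  Averaging over the
    translates of the syndrome gives a code as small as required. *)

(** * Single-coordinate flips, coverings and distance-3 codes *)

Section Flip.
Set Implicit Arguments.
Unset Strict Implicit.

Definition flip (I : finType) (x : {ffun I -> bool}) (k : I) : {ffun I -> bool} :=
  [ffun k' => (k' == k) (+) x k'].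

Lemma flipK (I : finType) (k : I) : involutive (fun x => flip x k).
Proof. by move=> x; apply/ffunP=> k'; rewrite !ffunE addKb. Qed.

Lemma hammingxx (n : nat) (x : cube n) : hamming x x = 0.
Proof. by apply: eq_card0 => i; rewrite !inE eqxx. Qed.

Lemma hamming_flip (n : nat) (x : cube n) (j : 'I_n) :
  hamming x (flip x j) = 1.
Proof.
rewrite /hamming (_ : [set i | _] = [set j]) ?cards1 //; apply/setP=> i.
by rewrite !inE ffunE; case: (i == j) (x i) => [] [].
Qed.

Lemma hamming_flip2 (n : nat) (x : cube n) (j k : 'I_n) :
  j != k -> hamming x (flip (flip x j) k) = 2.
Proof.
move=> neq_jk; rewrite /hamming (_ : [set i | _] = [set j; k]) ?cards2 ?neq_jk //.
apply/setP=> i; rewrite !inE !ffunE.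
have [->|_] := eqVneq i j; first by rewrite (negPf neq_jk); case: (x j).
by case: (i == k) (x i) => [] [].
Qed.

Lemma gamma_le (n : nat) (D : {set cube n}) : covering D -> gamma n <= #|D|.
Proof.
move=> covD; rewrite /gamma; case: arg_minnP => [|E _ minE]; last exact: minE.
exact: covering_setT.
Qed.

(** Reindexing along [enum_rank] preserves flips, so coverings may be built on words indexed by a
    structured sum type. *)
Lemma gamma_le_card (I : finType) (D : {set {ffun I -> bool}}) :
  (forall x, x \in D \/ exists k, flip x k \in D) -> gamma #|I| <= #|D|.
Proof.
move=> covD; pose f (x : {ffun I -> bool}) : cube #|I| := [ffun i => x (enum_val i)].
apply: leq_trans (leq_imset_card f D); apply: gamma_le; apply/forallP=> y.
pose x : {ffun I -> bool} := [ffun k => y (enum_rank k)].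
have fx : f x = y by apply/ffunP=> i; rewrite !ffunE enum_valK.
have [Dx|[k Dxk]] := covD x; apply/exists_inP.
  exists y; first by rewrite -fx imset_f.
  by rewrite hammingxx.
exists (flip y (enum_rank k)); last by rewrite hamming_flip.
suff <- : f (flip x k) = flip y (enum_rank k) by rewrite imset_f.
apply/ffunP=> i; rewrite !ffunE enum_valK; congr (_ (+) _).
by rewrite -(inj_eq (@enum_rank_inj _)) enum_valK.
Qed.

Lemma distance3_flip (n : nat) (C : {set cube n}) (x : cube n) (j : 'I_n) :
  distance3_code C -> x \in C -> flip x j \notin C.
Proof.
move=> /forall_inP dC Cx; apply/negP=> Cxj.
have /implyP := forall_inP (dC _ Cx) _ Cxj; rewrite hamming_flip.
by case: eqP (hamming_flip x j) => [<-|_ _ /(_ isT)//]; rewrite hammingxx.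
Qed.

Lemma distance3_flip2 (n : nat) (C : {set cube n}) (x : cube n) (j k : 'I_n) :
  distance3_code C -> x \in C -> flip (flip x j) k \in C -> j = k.
Proof.
move=> /forall_inP dC Cx Cxj; apply/eqP/negPn/negP=> neq_jk.
have /implyP := forall_inP (dC _ Cx) _ Cxj; rewrite (hamming_flip2 _ neq_jk).
by case: eqP (hamming_flip2 x neq_jk) => [<-|_ _ /(_ isT)//]; rewrite hammingxx.
Qed.

End Flip.

(** * The code attached to a labelling of the syndromes *)

Section Construction.
Set Implicit Arguments.
Unset Strict Implicit.
Import GRing.Theory.
Local Open Scope ring_scope.

Variable G : finZmodType.
Hypothesis addgg : forall g : G, g + g = 0.

(** In characteristic 2, inserting [k] into the index set and removing it have the same effect. *)
Lemma sum_flip (P : finType) (F : P -> G) (k : P) (u v : pred P) :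
  (forall p, v p = (p == k) (+) u p) ->
  \sum_(p | v p) F p = F k + \sum_(p | u p) F p.
Proof.
move=> vE; rewrite big_mkcond [in RHS]big_mkcond (bigD1 k) // [in RHS](bigD1 k) //=.
rewrite vE eqxx addrA; congr (_ + _).
  by case: (u k); rewrite /= ?addgg ?addr0.
by apply: eq_bigr => p /negPf neq_pk; rewrite vE neq_pk.
Qed.

Lemma addb_flip (P : finType) (k : P) (u v : pred P) :
  (forall p, v p = (p == k) (+) u p) ->
  \big[addb/false]_p v p = ~~ \big[addb/false]_p u p.
Proof.
move=> vE; rewrite (eq_bigr _ (fun p _ => vE p)) big_split /= (bigD1 k) //= eqxx.
by rewrite big1 // => p /negPf.
Qed.

Variables (q d m : nat) (t : 'I_q -> nat).
Hypotheses (le_qd : (q <= d)%N) (le_td : forall i : 'I_q, (i + t i <= d)%N).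
Variable C : forall i, {set cube (t i)}.
Hypothesis dist3C : forall i, distance3_code (C i).

Notation T := {i : 'I_q & 'I_(t i)}.
Notation A := (T + ('I_d + 'I_m))%type.
Notation Z := ('I_d.+1 + 'I_m)%type.
Notation word := {ffun A + Z -> bool}.

Variables (col : option A -> G) (lab : G -> option A).
Hypotheses (labK : cancel lab col) (col0 : col None = 0).

Definition block_col (i : 'I_q) (j : 'I_(t i)) : G :=
  col (Some (inl (Tagged (fun i => 'I_(t i)) j))).
Definition dir_col (p : 'I_d) : G := col (Some (inr (inl p))).
Definition tail_col (w : 'I_m) : G := col (Some (inr (inr w))).

Definition block (x : word) (i : 'I_q) : cube (t i) :=
  [ffun j => x (inl (inl (Tagged (fun i => 'I_(t i)) j)))].

Definition syndrome (x : word) : G := \sum_(a | x (inl a)) col (Some a).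

(* [y] itself, except that its last coordinate is replaced by its sum with the
   parity of the tail. *)
Definition head (x : word) (p : 'I_d.+1) : bool :=
  x (inr (inl p)) (+) ((p == ord_max) && \big[addb/false]_w x (inr (inr w))).

Definition tail_sum (x : word) : G := \sum_(w | x (inr (inr w))) tail_col w.

Definition widen_dir (i : 'I_q) : 'I_d.+1 := widen_ord (leqW le_qd) i.

(** Only the first [q] head coordinates are inspected: [None] also occurs on nonzero heads supported
    beyond them. *)
Definition first (u : 'I_d.+1 -> bool) : option 'I_q :=
  [pick i : 'I_q | u (widen_dir i) &&
     [forall i' : 'I_q, (i' < i)%N ==> ~~ u (widen_dir i')]].

(** The direction paired with coordinate [j] of block [i]. It lies strictly after [i], so flipping
    it cannot disturb [first = Some i]; by [le_td], [inord] never takes its default value. *)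
Definition dir (i : 'I_q) (j : 'I_(t i)) : 'I_d.+1 := inord (i + j).+1.

Definition lead (i : 'I_q) (u : cube (t i)) : G :=
  if [pick j | flip u j \in C i] is Some j then block_col j
  else dir_col (widen_ord le_qd i).

(* The map [f] of the header; it also depends on [x] through [block x i]. *)
Definition target (x : word) : G :=
  tail_sum x +
  if first (head x) is Some i
  then lead (block x i) + \sum_(j | head x (dir j)) @block_col i j
  else \sum_(p | head x (widen_ord (leqnSn d) p)) dir_col p.

Definition hole (x : word) : bool :=
  [forall p, ~~ head x p] && [forall i, block x i \in C i].

Definition code (s : G) : {set word} :=
  [set x | (syndrome x + s == target x) && ~~ hole x].

(** * Effect of a flip on each ingredient of the code *)

Lemma head_flip_inl (x : word) (a : A) : head (flip x (inl a)) =1 head x.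
Proof.
move=> p; rewrite /head ffunE /=; congr (_ (+) (_ && _)).
by apply: eq_bigr => w _; rewrite ffunE.
Qed.

Lemma head_flip_dir (x : word) (p p' : 'I_d.+1) :
  head (flip x (inr (inl p))) p' = (p' == p) (+) head x p'.
Proof.
rewrite /head ffunE /= -addbA; congr (_ (+) (_ (+) (_ && _))).
by apply: eq_bigr => w _; rewrite ffunE.
Qed.

Lemma head_flip_tail (x : word) (w : 'I_m) (p : 'I_d.+1) :
  head (flip x (inr (inr w))) p = (p == ord_max) (+) head x p.
Proof.
rewrite /head ffunE /= (@addb_flip _ w (fun w => x (inr (inr w)))); last first.
  by move=> w'; rewrite ffunE.
by case: (p == _) (x _) (\big[_/_]_w _) => [] [] [].
Qed.

Lemma tail_sum_flip (x : word) (k : A + Z) :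
  (forall w, inr (inr w) != k) -> tail_sum (flip x k) = tail_sum x.
Proof. by move=> kP; apply: eq_bigl => w; rewrite ffunE (negPf (kP w)). Qed.

Lemma tail_sum_flip_tail (x : word) (w : 'I_m) :
  tail_sum (flip x (inr (inr w))) = tail_col w + tail_sum x.
Proof. by apply: sum_flip => w'; rewrite ffunE. Qed.

Lemma syndrome_flip_inl (x : word) (a : A) :
  syndrome (flip x (inl a)) = col (Some a) + syndrome x.
Proof. by apply: sum_flip => a'; rewrite ffunE. Qed.

Lemma syndrome_flip_inr (x : word) (z : Z) :
  syndrome (flip x (inr z)) = syndrome x.
Proof. by apply: eq_bigl => a; rewrite ffunE. Qed.

Lemma block_flip_block (x : word) (i : 'I_q) (j : 'I_(t i)) :
  block (flip x (inl (inl (Tagged (fun i => 'I_(t i)) j)))) i = flip (block x i) j.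
Proof. by apply/ffunP=> j'; rewrite !ffunE; congr (_ (+) _); exact: eq_Tagged. Qed.

Lemma block_flip (x : word) (k : A + Z) (i : 'I_q) :
  (forall j, inl (inl (Tagged (fun i => 'I_(t i)) (j : 'I_(t i)))) != k) ->
  block (flip x k) i = block x i.
Proof. by move=> kP; apply/ffunP=> j; rewrite !ffunE (negPf (kP j)). Qed.

Lemma eq_first (u v : 'I_d.+1 -> bool) :
  (forall i, u (widen_dir i) = v (widen_dir i)) -> first u = first v.
Proof. by move=> uv; apply: eq_pick => i; rewrite /= uv; under eq_forallb do rewrite uv. Qed.

Lemma firstP (u : 'I_d.+1 -> bool) (i : 'I_q) :
  u (widen_dir i) -> (forall i' : 'I_q, (i' < i)%N -> ~~ u (widen_dir i')) ->
  first u = Some i.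
Proof.
move=> ui uP; rewrite /first; case: pickP => [k /andP[uk /forallP kP] | /(_ i)].
  congr Some; apply/val_inj/eqP; rewrite eqn_leq; apply/andP; split.
    by rewrite leqNgt; apply: contraL ui => lt_ik; have /implyP := kP i; apply.
  by rewrite leqNgt; apply: contraL uk => /uP.
by rewrite ui /=; case/forallP=> i'; apply/implyP/uP.
Qed.

Lemma first_some (u : 'I_d.+1 -> bool) (i : 'I_q) :
  first u = Some i ->
  u (widen_dir i) /\ (forall i' : 'I_q, (i' < i)%N -> ~~ u (widen_dir i')).
Proof.
rewrite /first; case: pickP => // k /andP[uk /forallP kP] [<-].
by split=> // i' lt_i; have /implyP := kP i'; apply.
Qed.

Lemma first_none (u : 'I_d.+1 -> bool) :
  (forall p, ~~ u p) -> first u = None.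
Proof. by move=> u0; rewrite /first; case: pickP => // i; rewrite (negPf (u0 _)). Qed.

Lemma dirE (i : 'I_q) (j : 'I_(t i)) : dir j = (i + j).+1 :> nat.
Proof. by rewrite inordK // ltnS; apply: leq_trans (le_td i); rewrite ltn_add2l. Qed.

Lemma first_flip_dir (x : word) (i : 'I_q) (j : 'I_(t i)) :
  first (head x) = Some i ->
  first (head (flip x (inr (inl (dir j))))) = Some i.
Proof.
case/first_some=> xi xP.
have E (i' : 'I_q) : (i' <= i)%N ->
    head (flip x (inr (inl (dir j)))) (widen_dir i') = head x (widen_dir i').
  move=> le_i; rewrite head_flip_dir (_ : (_ == _) = false) //.
  by apply/eqP=> /(congr1 val) /=; rewrite dirE; lia.
by apply: firstP => [|i' lt_i]; rewrite E // ?xP // ltnW.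
Qed.

Lemma lead_code (i : 'I_q) (u : cube (t i)) :
  u \in C i -> lead u = dir_col (widen_ord le_qd i).
Proof.
by move=> Cu; rewrite /lead; case: pickP => // j; rewrite (negPf (distance3_flip j (dist3C i) Cu)).
Qed.

Lemma lead_flip (i : 'I_q) (u : cube (t i)) (j : 'I_(t i)) :
  u \in C i -> lead (flip u j) = block_col j.
Proof.
move=> Cu; rewrite /lead; case: pickP => [k|/(_ j)]; last by rewrite flipK Cu.
by move/(distance3_flip2 (dist3C i) Cu) ->.
Qed.

Lemma hole_first (x : word) : [forall p, ~~ head x p] -> first (head x) = None.
Proof. by move=> /forallP; apply: first_none. Qed.

Lemma hole_target (x : word) : [forall p, ~~ head x p] -> target x = tail_sum x.
Proof.
move=> x0; rewrite /target hole_first // big_pred0 ?addr0 // => p.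
exact: negPf (forallP x0 _).
Qed.

(** * Covering radius 1, off the hole layers and on them *)

Lemma cover_off_hole (s : G) (x : word) :
  ~~ [forall p, ~~ head x p] -> x \in code s \/ exists k, flip x k \in code s.
Proof.
(* [e] is the defect in the code equation; its label [a] is the coordinate to correct. Flipping [a]
   works as long as [target] does not change, which can fail only for [a] in the leading block. *)
move=> nx0; pose e := syndrome x + s + target x.
have eE : syndrome x + s = e + target x by rewrite /e -addrA addgg addr0.
have nh y : head y =1 head x -> ~~ hole y.
  by move=> yx; rewrite /hole (eq_forallb (fun p => congr1 negb (yx p))) (negPf nx0).
case Dl: (lab e) (labK e) => [a|]; last first.
  by rewrite col0 => e0; left; rewrite inE eE -e0 add0r eqxx nh.
move=> De; right.
have flip_a : target (flip x (inl a)) = target x -> exists k, flip x k \in code s.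
  move=> tE; exists (inl a); rewrite inE nh ?andbT; last exact: head_flip_inl.
  by rewrite syndrome_flip_inl tE De -addrA eE addrA addgg add0r.
case Df: (first (head x)) => [i|]; last first.
  apply: flip_a; rewrite /target tail_sum_flip // (eq_first (fun=> head_flip_inl _ _ _)) Df.
  by congr (_ + _); apply: eq_bigl => p; rewrite head_flip_inl.
have [/existsP[j /eqP Da]|/existsPn/= na] :=
  boolP [exists j : 'I_(t i), inl (Tagged (fun i => 'I_(t i)) j) == a].
  (* This flip fixes the syndrome and the block, and adds [block_col j], that is [e], to the
     target. *)
  exists (inr (inl (dir j))); have fE := first_flip_dir j Df.
  rewrite inE syndrome_flip_inr; apply/andP; split.
    rewrite /target fE tail_sum_flip // block_flip //.
    rewrite (@sum_flip _ _ j (fun j => head x (dir j))); last first.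
      move=> j'; rewrite head_flip_dir; congr (_ (+) _).
      by rewrite -!val_eqE /= !dirE eqSS eqn_add2l.
    by rewrite eE -De -Da /target Df /block_col; apply/eqP; rewrite addrCA (addrCA (lead _)).
  rewrite /hole negb_and; apply/orP; left.
  by apply/negP=> /hole_first; rewrite fE.
apply: flip_a; rewrite /target tail_sum_flip // (eq_first (fun=> head_flip_inl _ _ _)) Df.
rewrite block_flip; last exact: na.
by congr (_ + (_ + _)); apply: eq_bigl => j; rewrite head_flip_inl.
Qed.

Lemma hole_flip_inr (x : word) (z : Z) :
  [forall p, ~~ head x p] -> ~~ hole (flip x (inr z)).
Proof.
move=> /forallP x0; rewrite /hole negb_and; apply/orP; left; apply/forallPn.
case: z => [p|w]; first by exists p; rewrite negbK head_flip_dir eqxx (negPf (x0 _)).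
by exists ord_max; rewrite negbK head_flip_tail eqxx (negPf (x0 _)).
Qed.

(** The last head direction [d] lies outside ['I_d]; there [insub] fails and the added term is 0. *)
Lemma target_flip_none (x : word) (p : 'I_d.+1) :
  [forall p, ~~ head x p] -> first (head (flip x (inr (inl p)))) = None ->
  target (flip x (inr (inl p))) =
  tail_sum x + oapp dir_col 0 (insub (val p)).
Proof.
move=> /forallP x0 fE; rewrite /target fE tail_sum_flip //; congr (_ + _).
case: insubP => [p' lt_p Dp|ge_p] /=.
  rewrite (@sum_flip _ _ p' xpred0) ?big_pred0 ?addr0 // => r.
  by rewrite head_flip_dir (negPf (x0 _)) !addbF -val_eqE /= -Dp.
rewrite big_pred0 // => r; rewrite head_flip_dir (negPf (x0 _)) addbF -val_eqE /=.
by apply: contraNF ge_p => /eqP r_p; rewrite -[\val p]r_p ltn_ord.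
Qed.

Lemma first_flip_free (x : word) (p : 'I_d.+1) :
  [forall p, ~~ head x p] -> (q <= p)%N -> first (head (flip x (inr (inl p)))) = None.
Proof.
move=> /forallP x0 le_qp; rewrite -(first_none x0); apply: eq_first => i.
rewrite head_flip_dir (_ : (_ == _) = false) //.
by apply/eqP=> /(congr1 val) /=; have := ltn_ord i; lia.
Qed.

Lemma first_flip_lead (x : word) (i : 'I_q) :
  [forall p, ~~ head x p] -> first (head (flip x (inr (inl (widen_dir i))))) = Some i.
Proof.
move=> /forallP x0; apply: firstP => [|i' lt_i]; rewrite head_flip_dir (negPf (x0 _)) addbF //.
by apply/eqP=> /(congr1 val) /=; lia.
Qed.

Lemma target_flip_lead (x : word) (i : 'I_q) :
  [forall p, ~~ head x p] ->
  target (flip x (inr (inl (widen_dir i)))) = tail_sum x + lead (block x i).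
Proof.
move=> x0; rewrite /target first_flip_lead // tail_sum_flip // block_flip // big_pred0 ?addr0 //.
move=> j; rewrite head_flip_dir (negPf (forallP x0 _)) addbF.
by apply/eqP=> /(congr1 val) /=; rewrite dirE; lia.
Qed.

Lemma cover_hole (s : G) (x : word) :
  [forall p, ~~ head x p] -> x \in code s \/ exists k, flip x k \in code s.
Proof.
move=> x0; pose e := syndrome x + s + tail_sum x.
have eE : syndrome x + s = tail_sum x + e by rewrite /e addrCA addgg addr0.
have flip_inr z : target (flip x (inr z)) = tail_sum x + e ->
    exists k, flip x k \in code s.
  move=> tE; exists (inr z); rewrite inE hole_flip_inr // andbT.
  by rewrite syndrome_flip_inr tE eE.
case Dl: (lab e) (labK e) => [a|]; last first.
  rewrite col0 => e0; have [hx|nhx] := boolP (hole x); last first.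
    by left; rewrite inE nhx andbT hole_target // eE -e0 addr0.
  (* [x] is itself a deleted codeword; the direction with zero label keeps its equation valid in the
     next layer. *)
  right; apply: (flip_inr (inl ord_max)).
  rewrite target_flip_none ?first_flip_free // -e0; congr (_ + _).
  by case: insubP => //= p; rewrite ltnn.
move=> De; right.
have flip0 : [forall p, ~~ head (flip x (inl a)) p].
  by apply/forallP=> p; rewrite head_flip_inl (forallP x0).
(* If the codeword that would cover [x] was deleted, its blocks lie in the [C i], and the kind of
   [a] decides which neighbouring layer takes over. *)
have [hx|nhx] := boolP (hole (flip x (inl a))); last first.
  exists (inl a); rewrite inE nhx andbT hole_target // tail_sum_flip //.
  by rewrite syndrome_flip_inl -addrA eE De addrCA addgg addr0.
have /andP[_ /forallP hC] := hx.
case: a De hx hC {Dl flip0} => [[i j]|[p|w]] De hx hC.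
- apply: (flip_inr (inl (widen_dir i))); rewrite target_flip_lead //; congr (_ + _).
  have := hC i; rewrite block_flip_block => Ci.
  by rewrite -(flipK j (block x i)) lead_flip // -De.
- have [lt_pq|le_qp] := ltnP p q.
    apply: (flip_inr (inl (widen_dir (Ordinal lt_pq)))); rewrite target_flip_lead //.
    have := hC (Ordinal lt_pq); rewrite block_flip // => Ci.
    by rewrite lead_code // -De; congr (_ + col (Some (inr (inl _)))); apply: val_inj.
  apply: (flip_inr (inl (widen_ord (leqnSn d) p))).
  by rewrite target_flip_none ?first_flip_free //= valK -De.
(* The tail flip also toggles the last head coordinate, which is not a leading one ([q <= d]) and
   contributes nothing to the target. *)
- apply: (flip_inr (inr w)); rewrite /target (_ : first _ = None); last first.
    rewrite -(hole_first x0); apply: eq_first => i; rewrite head_flip_tail.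
    by rewrite (_ : (_ == _) = false) //; apply/eqP=> /(congr1 val) /=; have := ltn_ord i; lia.
  rewrite tail_sum_flip_tail big_pred0 ?addr0; first by rewrite addrC -De.
  move=> p; rewrite head_flip_tail (negPf (forallP x0 _)) addbF.
  by apply/eqP=> /(congr1 val) /=; have := ltn_ord p; lia.
Qed.

Lemma gamma_le_code (s : G) : (gamma #|{: A + Z}| <= #|code s|)%N.
Proof.
apply: gamma_le_card => x; have [x0|nx0] := boolP [forall p, ~~ head x p].
  exact: cover_hole.
exact: cover_off_hole.
Qed.

(** * Counting holes and averaging over the translates *)

Lemma sum_card_code : (\sum_s #|code s| + #|[set x | hole x]| = 2 ^ #|{: A + Z}|)%N.
Proof.
have <- : #|{: word}| = (2 ^ #|{: A + Z}|)%N by rewrite card_ffun card_bool.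
rewrite -cardsT -(cardsID [set x | hole x] setT) setTI addnC; congr (_ + _)%N.
under eq_bigr do rewrite -sum1_card big_mkcond.
rewrite exchange_big -sum1_card [in RHS]big_mkcond; apply: eq_bigr => x _ /=.
under eq_bigr do rewrite inE; rewrite !inE andbT.
have [_|_] := boolP (hole x); first by rewrite big1 // => s _; rewrite andbF.
(* A word that is not a hole lies in the code of exactly this translate. *)
rewrite (bigD1 (syndrome x + target x)) //= big1 => [|s]; last first.
  move=> ns; case: eqP => // E; case/eqP: ns.
  by rewrite -E addrA addgg add0r.
by rewrite addrA addgg add0r eqxx.
Qed.

Lemma card_hole :
  (2 ^ (d + m + m) * \prod_i #|C i| <= #|[set x | hole x]|)%N.
Proof.
pose F := [set f : {dffun forall i, cube (t i)} | f \in family (fun i => [pred u in C i])].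
have <- : (#|setX (setX F [set: {ffun 'I_d + 'I_m -> bool}]) [set: {ffun 'I_m -> bool}]| =
    2 ^ (d + m + m) * \prod_i #|C i|)%N.
  rewrite !cardsX !cardsT !card_ffun card_bool card_sum !card_ord mulnAC -mulnA mulnC -expnD.
  rewrite (addnC m); congr (_ * _)%N; rewrite cardsE card_family foldrE big_map big_enum /=.
  by apply: eq_bigr => i _; apply: eq_card.
(* Block codewords, the other [d + m] coordinates of the syndrome part and the tail are free; the
   zero head then forces the rest, its last coordinate being the tail parity. *)
pose Phi (p : {dffun forall i, cube (t i)} * {ffun 'I_d + 'I_m -> bool} *
    {ffun 'I_m -> bool}) : word := [ffun k => match k with
  | inl (inl ij) => p.1.1 (tag ij) (tagged ij)
  | inl (inr r) => p.1.2 r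
  | inr (inl r) => (r == ord_max) && \big[addb/false]_w p.2 w
  | inr (inr w) => p.2 w end].
rewrite -(@card_imset _ _ Phi) => [|[[f g] e] [[f' g'] e'] /ffunP E]; last first.
  congr (_, _, _).
  - apply/ffunP=> i; apply/ffunP=> j.
    by have := E (inl (inl (Tagged (fun i => 'I_(t i)) j))); rewrite !ffunE.
  - by apply/ffunP=> r; have := E (inl (inr r)); rewrite !ffunE.
  - by apply/ffunP=> w; have := E (inr (inr w)); rewrite !ffunE.
apply/subset_leq_card/subsetP=> _ /imsetP[[[f g] e]] /setXP[/setXP[Ff _] _] ->.
rewrite inE; apply/andP; split.
  apply/forallP=> r; rewrite /head ffunE.
  by under [X in _ (+) (_ && X)]eq_bigr do rewrite ffunE; rewrite addbb.
apply/forallP=> i; rewrite (_ : block _ i = f i); last first.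
  by apply/ffunP=> j; rewrite !ffunE.
by move: Ff; rewrite inE => /familyP/(_ i).
Qed.

Lemma gamma_saving :
  (gamma #|{: A + Z}| * #|G| + 2 ^ (d + m + m) * \prod_i #|C i| <= 2 ^ #|{: A + Z}|)%N.
Proof.
rewrite -sum_card_code leq_add ?card_hole // mulnC -sum_nat_const.
by apply: leq_sum => s _; apply: gamma_le_code.
Qed.

End Construction.

(** * Parameters supplied by a decomposition *)

Lemma distance3_code_lambda (s : nat) :
  {C : {set cube s} | distance3_code C & #|C| = lambda s}.
Proof.
have [|C dC cardC] := @eq_bigmax_cond _ (@distance3_code s) (fun C => #|C|).
  by apply/card_gt0P; exists set0; apply/forall_inP=> x; rewrite inE.
by exists C => //; rewrite -cardC.
Qed.

Lemma sorted_gtn_nth (d i : nat) (s : seq nat) :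
  sorted gtn s -> (forall k, k \in s -> k <= d) -> i < size s ->
  i + nth 0 s i <= d.
Proof.
move=> s_sorted s_le; elim: i => [|i IHi] lt_i.
  by apply: s_le; rewrite mem_nth.
apply: leq_trans (IHi (ltnW lt_i)); rewrite addSnnS leq_add2l.
by have /(sortedP 0)/(_ i) := s_sorted; apply.
Qed.

Lemma pointed_enumeration (G : finZmodType) (A : finType) :
  #|G| = #|A|.+1 ->
  {col : option A -> G & {lab | cancel lab col & col None = 0%R}}.
Proof.
move=> cardG; have cardE : #|G| = #|{: option A}| by rewrite card_option.
pose b a := enum_val (cast_ord (esym cardE) (enum_rank a)).
pose c g := enum_val (cast_ord cardE (enum_rank g)).
have cK : cancel c b by move=> g; rewrite /b /c enum_valK cast_ordK enum_rankK.
(* Translating an arbitrary bijection by [b None] sends [None] to 0. *)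
exists (fun a => b a - b None)%R; exists (fun g => c (g + b None)%R).
  by move=> g; rewrite cK GRing.addrK.
exact: GRing.subrr.
Qed.

Lemma gamma_decomposition_le (h d m : nat) (S : seq nat) :
  decomposition (2 ^ h - 1) d.+1 m S -> size S <= d ->
  gamma (2 ^ h - 1 + d.+1 + m) * 2 ^ h + 2 ^ (d + m + m) * \prod_(s <- S) lambda s
    <= 2 ^ (2 ^ h - 1 + d.+1 + m).
Proof.
case=> sortedS S_lt sumS le_Sd.
(* Decreasing order is what gives [i + t i <= d]: each step loses at least 1. *)
pose t (i : 'I_(size S)) := nth 0 (rev S) i.
have le_td (i : 'I_(size S)) : i + t i <= d.
  apply: sorted_gtn_nth; first by rewrite rev_sorted.
    by move=> k; rewrite mem_rev => /S_lt/andP[].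
  by rewrite size_rev.
have big_t (R : Type) (idx : R) (op : Monoid.com_law idx) (F : nat -> R) :
    \big[op/idx]_i F (t i) = \big[op/idx]_(s <- S) F s.
  have rS : perm_eq (rev S) S by rewrite perm_rev.
  by rewrite -(perm_big _ rS) (big_nth 0) size_rev big_mkord.
have h_gt0 : 0 < 2 ^ h by rewrite expn_gt0.
pose A := ({i : 'I_(size S) & 'I_(t i)} + ('I_d + 'I_m))%type.
have cardA : #|{: A}| = 2 ^ h - 1.
  rewrite !card_sum !card_ord card_tagged sumnE big_map big_enum /=.
  under eq_bigr do rewrite card_ord.
  have -> : \sum_i t i = \sum_(s <- S) s by exact: (big_t _ _ addn id).
  lia.
have cardG : #|{: 'rV['F_2]_h}| = 2 ^ h by rewrite card_mx card_Fp // mul1n.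
have addgg (g : 'rV['F_2]_h) : (g + g = 0)%R.
  by apply/rowP=> i; rewrite !mxE GRing.addrr_pchar2 // pchar_Fp.
have [|col [lab labK col0]] := @pointed_enumeration 'rV['F_2]_h A.
  by rewrite cardG cardA; lia.
pose C i := distance3_code_lambda (t i).
have := gamma_saving addgg le_Sd le_td (fun i => s2valP (C i)) labK col0.
rewrite cardG (eq_bigr (fun i => lambda (t i))) => [|i _]; last exact: (s2valP' (C i)).
rewrite (big_t _ _ muln lambda).
by rewrite card_sum cardA !card_sum !card_ord addnA.
Qed.

(** Excludes the boundary case in which [hat] would jump to [h + 1]. Equality would give
    [2 ^ h < 2 * theta], hence [theta ^ 2 < 5 * theta], whereas [8 <= 2 ^ h] forces [5 <= theta]. *)
Lemma Theta_add_neq (h theta xi m : nat) :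
  2 < h -> Theta (2 ^ h) (theta, xi) -> m < theta -> theta + m != 2 ^ h.
Proof.
move=> h_gt2 [E lt_xi] lt_m; apply/eqP=> Em.
have : 2 ^ 3 <= 2 ^ h by rewrite leq_exp2l.
have := bin_ffact theta.+1 2; rewrite ffactSS ffactn1 E -Em (_ : 2`! = 2) // (_ : 2 ^ 3 = 8) //=.
move=> quad pow.
have : 5 * theta <= theta * theta by rewrite leq_mul2r; lia.
lia.
Qed.

Theorem theorem3 (h theta xi m : nat) (S : seq nat)
  (h_gt2 : (2 < h)%N)
  (theta_xi : Theta (2 ^ h) (theta, xi))
  (S_decomp : decomposition (2 ^ h - 1) theta m S)
  (m_lt : (m < theta - size S)%N) :
  let n := (2 ^ h - 1 + theta)%N in
  (chi (n + m)%N >=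
   2%:R ^ (m%:Z - (2 ^ h)%N%:Z) * \prod_(s <- S) (lambda s)%:R)%R.
Proof.
cbv zeta.
have lt_theta_m : theta + m < 2 ^ h.
  have [_ _ sumS] := S_decomp; rewrite ltn_neqAle; apply/andP; split.
    by apply: Theta_add_neq h_gt2 theta_xi _; lia.
  by have : 0 < 2 ^ h by [rewrite expn_gt0]; lia.
have [hatE _] := @hat_check_uniq (2 ^ h - 1 + theta + m) h (theta + m) (esym (addnA _ _ _)) lt_theta_m.
rewrite /chi hatE {hatE}.
case: theta => [|d] in theta_xi S_decomp m_lt lt_theta_m *; first by lia.
have le_Sd : size S <= d by lia.
have := gamma_decomposition_le S_decomp le_Sd.
rewrite -(ler_nat rat) natrD !natrM !natrX natr_prod => saving.
have zexp (a b : nat) : (2%:R ^ (a%:Z - b%:Z) = 2%:R ^+ a / 2%:R ^+ b :> rat)%R.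
  by rewrite expfzDr ?pnatr_eq0 // -exprnP -exprnN.
have N_eq : 2 ^ h - 1 + d.+1 + m = 2 ^ h + d + m.
  by have : 0 < 2 ^ h by [rewrite expn_gt0]; lia.
have exp_gt0 k : (0 < 2%:R ^+ k :> rat)%R by rewrite exprn_gt0 // ltr0n.
move: saving; rewrite !zexp N_eq; move: (2 ^ h) => K saving.
(* Once scaled by the size of the cube, the claim has the same two sides as [saving]. *)
rewrite lerBrDr -(ler_pM2r (exp_gt0 (K + d + m))) mul1r.
apply: le_trans saving; rewrite le_eqVlt; apply/orP; left; apply/eqP.
rewrite !exprD; field.
by rewrite !expf_neq0 // pnatr_eq0.
Qed.
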